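(* Up to isomorphism, the minimal signed Petersen graphs are precisely the six signed graphs $+P$, $P_1$, $P_{2,2}$, $P_{3,2}$, $P_{2,3}$, $P_{3,3}$. Each of these is the unique isomorphism type of minimal signed graph in its switching isomorphism class. Their frustration indices are $l(+P)=0$, $l(P_1)=1$, $l(P_{2,2})=2$, $l(P_{2,3})=2$, $l(P_{3,2})=3$, $l(P_{3,3})=3$.
   Context: The Petersen graph $P$ has vertices $v_{ij}$ indexed by the 2-element subsets $\{i,j\}$ of $\{1,\dots,5\}$, with $v_{ij}v_{kl}$ an edge iff $\{i,j\}\cap\{k,l\}=\emptyset$. A signed graph $\Sigma=(\Gamma,\sigma)$ has signature $\sigma:E\to\{+,-\}$; $E^-$ is its set of negative edges. It is balanced if every cycle has positive sign product. The frustration index $l(\Sigma)$ is the smallest number of edges whose deletion leaves a balanced signed graph. $\Sigma$ is called minimal if $|E^-(\Sigma)|=l(\Sigma)$. Switching by $\zeta:V\to\{+,-\}$ gives $\sigma^\zeta(vw)=\zeta(v)\sigma(vw)\zeta(w)$; two signed graphs are switching isomorphic if one is isomorphic (via a sign-preserving graph isomorphism) to a switching of the other. Edge distance is distance in the line graph; in $P$ two disjoint edges are at distance 2 if some edge joins an endpoint of one to an endpoint of the other, and at distance 3 otherwise. $+P$: all edges positive; $P_1$: exactly one negative edge; $P_{2,2}$ / $P_{2,3}$: exactly two negative edges at distance 2 / 3; $P_{3,2}$: exactly three negative edges forming alternate edges of a 6-cycle of $P$; $P_{3,3}$: exactly three negative edges pairwise at distance 3. *)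

(* Defs.v *)
From mathcomp Require Import all_boot.

Set Implicit Arguments.
Unset Strict Implicit.
Unset Printing Implicit Defensive.

Record sgraph := SGraph {
  vert :> finType;
  adj : rel vert;
  adj_sym : symmetric adj;
  adj_irr : irreflexive adj }.

Definition edges (G : sgraph) : {set {set G}} :=
  [set [set p.1; p.2] | p : G * G & adj p.1 p.2].

Lemma in_edges (G : sgraph) (x y : G) : ([set x; y] \in edges G) = adj x y.
Proof.
apply/imsetP/idP => [[[a b] /=]|xy]; last by exists (x, y); rewrite ?inE.
rewrite inE /= => ab eq_xy.
have neq_ab : a != b by apply: contraTneq ab => ->; rewrite adj_irr.
have := set21 a b; have := set22 a b; rewrite -eq_xy !inE.
move=> /orP[]/eqP Eb /orP[]/eqP Ea; rewrite -?Ea -?Eb //.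
- by rewrite Ea Eb eqxx in neq_ab.
- by rewrite adj_sym.
- by rewrite Ea Eb eqxx in neq_ab.
Qed.

(* Signs are booleans: false is +, true is -, so the product of signs is     *)
(* addb.  sgn is total on vertex sets, but only its values on edges matter:  *)
(* every notion below (in particular isomorphism) ignores the other values.  *)
Record signed_graph := SignedGraph {
  under :> sgraph;
  sgn : {set under} -> bool }.

Section SignedGraphs.
Implicit Types S T : signed_graph.

Definition neg_edges S : {set {set S}} := [set e in edges S | sgn e].

Definition is_cycle (G : sgraph) (c : seq G) : bool :=
  (2 < size c) && ucycleb (@adj G) c.

Definition cycle_sgn S (c : seq S) : bool :=
  \big[addb/false]_(x <- c) sgn [set x; next c x].

(* A cycle has no repeated vertex, so bounding its length by #|S| loses      *)
(* nothing; see balancedP.                                                   *)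
Definition balanced S : bool :=
  [forall n : 'I_#|S|.+1, forall c : n.-tuple S,
     is_cycle c ==> (cycle_sgn c == false)].

Lemma balancedP S :
  reflect (forall c : seq S, is_cycle c -> cycle_sgn c = false) (balanced S).
Proof.
apply: (iffP idP) => [balS c cycc | balS]; last first.
  apply/forallP => n; apply/forallP => c; apply/implyP => cycc.
  by apply/eqP/balS.
have ltc : size c < #|S|.+1.
  rewrite ltnS; case/and3P: cycc => _ _ /card_uniqP <-; exact: max_card.
have /forallP/(_ (in_tuple c)) := forallP balS (Ordinal ltc).
by move=> /implyP/(_ cycc)/eqP.
Qed.

Section Delete.
Variables (G : sgraph) (D : {set {set G}}).

Definition delete_adj : rel G := fun x y => adj x y && ([set x; y] \notin D).

Lemma delete_sym : symmetric delete_adj.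
Proof. by move=> x y; rewrite /delete_adj adj_sym setUC. Qed.

Lemma delete_irr : irreflexive delete_adj.
Proof. by move=> x; rewrite /delete_adj adj_irr. Qed.

Definition delete_graph : sgraph := SGraph delete_sym delete_irr.
End Delete.

Definition delete S (D : {set {set S}}) : signed_graph :=
  @SignedGraph (delete_graph D) (@sgn S).

Definition frustration_le S (k : nat) : bool :=
  [exists D : {set {set S}},
     [&& D \subset edges S, #|D| == k & balanced (delete D)]].

Lemma frustration_ex S : exists k, frustration_le S k.
Proof.
exists #|edges S|; apply/existsP; exists (edges S); rewrite subxx eqxx /=.
apply/balancedP => -[|x [|y c]] // /and3P[_ /=].
by rewrite /= {1}/delete_adj in_edges andbN.
Qed.

Definition frustration_index S : nat := ex_minn (frustration_ex S).

Definition minimal S : Prop := #|neg_edges S| = frustration_index S.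

(* For e = {v, w} this is zeta(v) sigma(vw) zeta(w); see sgn_switch.         *)
Definition switch S (zeta : S -> bool) : signed_graph :=
  @SignedGraph S (fun e => sgn e (+) \big[addb/false]_(v in e) zeta v).

Lemma sgn_switch S (zeta : S -> bool) (v w : S) : adj v w ->
  sgn (s := switch zeta) [set v; w] = zeta v (+) sgn [set v; w] (+) zeta w.
Proof.
move=> vw; have neq_vw : v != w by apply: contraTneq vw => ->; rewrite adj_irr.
rewrite /= big_setU1 ?inE //= big_set1.
by rewrite addbA [zeta v (+) _]addbC.
Qed.

Definition isomorphic S T : Prop :=
  exists f : S -> T,
    [/\ bijective f,
        forall x y, adj (f x) (f y) = adj x y &
        forall x y, adj x y -> sgn [set f x; f y] = sgn [set x; y]].

Definition switching_isomorphic S T : Prop :=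
  exists zeta : T -> bool, isomorphic S (switch zeta).

End SignedGraphs.

Definition distance (V : finType) (r : rel V) (x y : V) (d : nat) : Prop :=
  (exists p, [/\ path r x p, last x p = y & size p = d]) /\
  (forall p, path r x p -> last x p = y -> d <= size p).

Definition line_adj (G : sgraph) : rel {set G} := fun e f =>
  [&& e \in edges G, f \in edges G, e != f & e :&: f != set0].

Definition edge_distance (G : sgraph) (e f : {set G}) (d : nat) : Prop :=
  distance (@line_adj G) e f d.

Section Petersen.

Definition petersen_vert : finType := {A : {set 'I_5} | #|A| == 2}.

Definition petersen_adj : rel petersen_vert :=
  fun A B => [disjoint val A & val B].

Lemma petersen_sym : symmetric petersen_adj.
Proof. by move=> A B; rewrite /petersen_adj disjoint_sym. Qed.

Lemma petersen_irr : irreflexive petersen_adj.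
Proof.
move=> A; apply/negP; rewrite /petersen_adj -setI_eq0 setIid -cards_eq0.
by rewrite (eqP (valP A)).
Qed.

Definition petersen : sgraph := SGraph petersen_sym petersen_irr.

Definition signed_petersen (sigma : {set petersen} -> bool) : signed_graph :=
  SignedGraph sigma.

Definition neg_at_distance (k d : nat) (S : signed_graph) : Prop :=
  #|neg_edges S| = k /\
  {in neg_edges S &, forall e f, e != f -> edge_distance e f d}.

Definition neg_alternate_hexagon (S : signed_graph) : Prop :=
  exists a b c d e f : S,
    is_cycle [:: a; b; c; d; e; f] /\
    neg_edges S = [set [set a; b]; [set c; d]; [set e; f]].

Inductive petersen_type := PlusP | P_1 | P_2_2 | P_3_2 | P_2_3 | P_3_3.

Definition has_type (t : petersen_type) (S : signed_graph) : Prop :=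
  match t with
  | PlusP => neg_edges S = set0
  | P_1 => #|neg_edges S| = 1
  | P_2_2 => neg_at_distance 2 2 S
  | P_3_2 => neg_alternate_hexagon S
  | P_2_3 => neg_at_distance 2 3 S
  | P_3_3 => neg_at_distance 3 3 S
  end.

End Petersen.

(* Main.v *)
Require Import Defs.
From mathcomp Require Import all_boot.

Set Implicit Arguments.
Unset Strict Implicit.
Unset Printing Implicit Defensive.

(* Cycle signs are invariant under switching, so l(S) <= |E^-(S^zeta)| for    *)
(* every zeta.  Hence in a minimal signed graph at most half the edges of any *)
(* cut are negative; in the Petersen graph the cuts around single vertices    *)
(* and around paths on three vertices already leave only the six types, up to *)
(* the action of S_5.  Conversely, l is bounded below by checking that no     *)
(* smaller set of edges meets all negative 5- and 6-cycles.  Finally the      *)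
(* frustration index and the existence of an edge all of whose pentagons are  *)
(* negative are switching and isomorphism invariants, and together they       *)
(* separate the types.  The finite checks run on Petersen vertices {a, b}     *)
(* encoded as pairs of numbers a < b < 5.                                     *)

(** * Switching and isomorphism invariance *)

(** Switching changes no cycle sign ([cycle_sgn_switch]), hence no frustration index, so no
    switching of a minimal graph has fewer negative edges. Switching a vertex set reverses the signs
    exactly on its cut, so minimality allows at most half of each cut to be negative
    ([minimal_cut]). At a vertex this makes the negative edges a matching; at a path on three
    vertices it allows at most two of the five cut edges. An exhaustive search ([minimal_canon])
    then leaves only S_5-images of the six configurations in [canon], and [has_type_canon] shows
    that each description picks out one isomorphism class. Conversely, a set whose deletion balances
    the graph meets every negative cycle, and pentagons and hexagons alone force it to be as large
    as the set of negative edges ([canon_frustration]). The index leaves two ambiguous pairs,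
    [P_2_2] with [P_2_3] and [P_3_2] with [P_3_3]. An edge all of whose pentagons are negative
    exists only in the second member of each ([canon_separated]). Both invariants survive switching,
    which gives uniqueness in each switching class. *)

Definition cycle_edges (T : Type) (c : seq T) : seq (T * T) := zip c (rot 1 c).

Lemma cycle_edges_map (T U : Type) (h : T -> U) (c : seq T) :
  cycle_edges (map h c) = [seq (h p.1, h p.2) | p <- cycle_edges c].
Proof.
by rewrite /cycle_edges -map_rot; elim: c (rot 1 c) => [|x s IH] [|y t] //=; rewrite IH.
Qed.

Lemma cycle_all (T : Type) (r : rel T) (c : seq T) :
  cycle r c = all (fun p => r p.1 p.2) (cycle_edges c).
Proof.
case: c => // x s; rewrite /cycle_edges rot1_cons /=.
by elim: s {1 3}x => [|y s IH] z /=; rewrite ?andbT // IH.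
Qed.

Lemma map_next (T : eqType) (c : seq T) : uniq c -> map (next c) c = rot 1 c.
Proof.
case: c => // x s Us; rewrite rot1_cons.
apply: (@eq_from_nth _ x) => [|i]; rewrite size_map ?size_rcons // => ltis.
rewrite (nth_map x) // next_nth mem_nth // index_uniq // nth_rcons.
by move: ltis; rewrite ltnS; case: ltngtP => // ->; rewrite nth_default.
Qed.

(** On a repetition-free list [next c] is rotation by one step. This turns a sign product written
    with [next] into one over consecutive pairs, which can be mapped and computed. *)
Lemma big_next (T : eqType) R (idx : R) (op : R -> R -> R) (F : T -> T -> R) (c : seq T) :
  uniq c -> \big[op/idx]_(x <- c) F x (next c x)
          = \big[op/idx]_(p <- cycle_edges c) F p.1 p.2.
Proof.
move=> Uc; rewrite /cycle_edges -(map_next Uc); move: (next c) => f.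
have -> : zip c (map f c) = [seq (x, f x) | x <- c] by elim: c {Uc} => //= x s ->.
by rewrite big_map.
Qed.

(** Each vertex of the cycle contributes its [zeta] twice, once as itself and once as a successor,
    because [next] permutes the cycle. *)
Lemma cycle_sgn_switch (S : signed_graph) (zeta : S -> bool) (c : seq S) :
  is_cycle c -> cycle_sgn (S := switch zeta) c = cycle_sgn c.
Proof.
case/and3P => _ cyc Uc; rewrite /cycle_sgn.
rewrite (eq_big_seq (fun x => sgn [set x; next c x] (+) (zeta x (+) zeta (next c x)))).
  rewrite big_split /= [X in _ (+) X]big_split /=.
  rewrite -[X in _ (+) (_ (+) X)](big_map (next c) xpredT) map_next //.
  have -> : \big[addb/false]_(i <- rot 1 c) zeta i = \big[addb/false]_(i <- c) zeta i.
    by apply: perm_big; rewrite perm_rot.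
  by rewrite addbb addbF.
move=> x xc; rewrite sgn_switch ?(next_cycle cyc) //.
by rewrite addbAC addbC addbA.
Qed.

Lemma balanced_switch (S : signed_graph) (zeta : S -> bool) :
  balanced (switch zeta) = balanced S.
Proof.
by apply/balancedP/balancedP => balS c cyc; have := balS c cyc; rewrite cycle_sgn_switch.
Qed.

Lemma frustration_le_switch (S : signed_graph) (zeta : S -> bool) k :
  frustration_le (switch zeta) k = frustration_le S k.
Proof.
apply: eq_existsb => D; congr (_ && (_ && _)).
exact: (@balanced_switch (@delete S D) zeta).
Qed.

Lemma frustration_index_eq (S T : signed_graph) :
  frustration_le S =1 frustration_le T -> frustration_index S = frustration_index T.
Proof. by move=> eqST; apply: eq_ex_minn. Qed.

Lemma frustration_switch (S : signed_graph) (zeta : S -> bool) :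
  frustration_index (switch zeta) = frustration_index S.
Proof. exact/frustration_index_eq/frustration_le_switch. Qed.

Lemma edgesP (G : sgraph) (e : {set G}) :
  reflect (exists x y, adj x y /\ e = [set x; y]) (e \in edges G).
Proof.
apply: (iffP imsetP) => [[[x y]]|[x [y [xy ->]]]].
  by rewrite inE => xy ->; exists x, y.
by exists (x, y); rewrite ?inE.
Qed.

Lemma balanced_delete_neg (S : signed_graph) : balanced (delete (neg_edges S)).
Proof.
apply/balancedP => c /and3P[_ cyc Uc]; apply: big1_seq => x /= xc.
have := next_cycle cyc xc; rewrite /= /delete_adj inE in_edges.
by case/andP=> ->; case: sgn.
Qed.

Lemma frustration_le_neg (S : signed_graph) : frustration_le S #|neg_edges S|.
Proof.
apply/existsP; exists (neg_edges S); rewrite eqxx balanced_delete_neg /= andbT.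
by apply/subsetP => e; rewrite inE => /andP[].
Qed.

Lemma frustration_neg (S : signed_graph) : frustration_index S <= #|neg_edges S|.
Proof.
by rewrite /frustration_index; case: ex_minnP => m _; apply; apply: frustration_le_neg.
Qed.

Lemma minimal_switch (S : signed_graph) (zeta : S -> bool) :
  minimal S -> #|neg_edges S| <= #|neg_edges (switch zeta)|.
Proof. by move=> ->; rewrite -(frustration_switch zeta) frustration_neg. Qed.

Lemma isomorphic_sym S T : isomorphic S T -> isomorphic T S.
Proof.
case=> f [[g fK gK] fadj fsgn]; exists g; split; first by exists f.
  by move=> x y; rewrite -fadj !gK.
by move=> x y xy; rewrite -fsgn ?gK // -fadj !gK.
Qed.

Lemma isomorphic_trans S T U : isomorphic S T -> isomorphic T U -> isomorphic S U.
Proof.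
case=> f [fB fadj fsgn] [g [gB gadj gsgn]]; exists (g \o f); split=> /=.
- exact: bij_comp.
- by move=> x y; rewrite gadj.
- by move=> x y xy; rewrite gsgn ?fadj // fsgn.
Qed.

Lemma is_cycle_map (S T : sgraph) (f : S -> T) (c : seq S) :
  injective f -> (forall x y, adj (f x) (f y) = adj x y) ->
  is_cycle (map f c) = is_cycle c.
Proof.
move=> fI fadj; rewrite /is_cycle /ucycleb size_map map_inj_uniq // !cycle_all.
by rewrite cycle_edges_map all_map (@eq_all _ _ (fun p => adj p.1 p.2)) // => p /=.
Qed.

Lemma cycle_sgn_map (S T : signed_graph) (f : S -> T) (c : seq S) :
  injective f -> (forall x y, adj x y -> sgn [set f x; f y] = sgn [set x; y]) ->
  is_cycle c -> cycle_sgn (map f c) = cycle_sgn c.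
Proof.
move=> fI fsgn /and3P[_ cyc Uc]; rewrite /cycle_sgn big_map; apply: eq_big_seq => x xc.
by rewrite next_map // fsgn // (next_cycle cyc).
Qed.

Lemma balanced_isomorphic S T : isomorphic S T -> balanced T -> balanced S.
Proof.
case=> f [/bij_inj fI fadj fsgn] /balancedP balT; apply/balancedP => c cyc.
by rewrite -(cycle_sgn_map fI fsgn cyc) balT ?is_cycle_map.
Qed.

Lemma imset_pair (aT rT : finType) (f : aT -> rT) x y : f @: [set x; y] = [set f x; f y].
Proof. by rewrite imsetU1 imset_set1. Qed.

Lemma isomorphic_frustration_le S T k :
  isomorphic S T -> frustration_le S k -> frustration_le T k.
Proof.
move=> isoST; case: (isoST) => f [fB fadj fsgn] /existsP[D /and3P[sDE /eqP cD balD]].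
have fI := bij_inj fB; have FI := imset_inj fI.
apply/existsP; exists [set f @: e | e : {set S} in D]; rewrite card_imset // cD eqxx /=.
apply/andP; split.
  apply/subsetP => _ /imsetP[e /(subsetP sDE) /edgesP[x [y [xy ->]]] ->].
  by rewrite imset_pair in_edges fadj.
apply: balanced_isomorphic balD; apply: isomorphic_sym; exists f; split=> //= x y.
  by rewrite /delete_adj fadj -imset_pair (mem_imset _ _ FI).
by case/andP=> xy _; apply: fsgn.
Qed.

Lemma isomorphic_frustration S T :
  isomorphic S T -> frustration_index S = frustration_index T.
Proof.
move=> isoST; apply: frustration_index_eq => k.
by apply/idP/idP; apply: isomorphic_frustration_le => //; apply: isomorphic_sym.
Qed.

Lemma isomorphic_card_neg_le S T :
  isomorphic S T -> #|neg_edges S| <= #|neg_edges T|.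
Proof.
case=> f [fB fadj fsgn]; have FI := imset_inj (bij_inj fB).
rewrite -(card_imset _ FI); apply/subset_leq_card/subsetP => _ /imsetP[e + ->].
rewrite !inE => /andP[/edgesP[x [y [xy ->]]]].
by rewrite imset_pair in_edges fadj xy fsgn.
Qed.

Lemma isomorphic_minimal S T : isomorphic S T -> minimal S -> minimal T.
Proof.
move=> isoST; rewrite /minimal (isomorphic_frustration isoST) => <-.
by apply/eqP; rewrite eqn_leq !isomorphic_card_neg_le //; apply: isomorphic_sym.
Qed.

(** An invariant of switching isomorphism that distinguishes types with equal frustration index. *)
Definition has_negative_pentagon_edge (S : signed_graph) : Prop :=
  exists x y : S, adj x y /\
    forall a b c, is_cycle [:: x; y; a; b; c] -> cycle_sgn [:: x; y; a; b; c].

Lemma isomorphic_pentagon_edge S T :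
  isomorphic S T -> has_negative_pentagon_edge S -> has_negative_pentagon_edge T.
Proof.
case=> f [fB fadj fsgn] [x [y [xy neg]]]; have fI := bij_inj fB.
have [g fK gK] := fB; exists (f x), (f y); rewrite fadj; split=> // a b c.
rewrite -(gK a) -(gK b) -(gK c) -[[:: f x; _; _; _; _]]/(map f [:: x; y; g a; g b; g c]).
by rewrite is_cycle_map // => cyc; rewrite cycle_sgn_map // neg.
Qed.

Lemma switch_pentagon_edge (S : signed_graph) (zeta : S -> bool) :
  has_negative_pentagon_edge (switch zeta) <-> has_negative_pentagon_edge S.
Proof.
by split=> -[x [y [xy neg]]]; exists x, y; split=> // a b c cyc;
  have := neg a b c cyc; rewrite cycle_sgn_switch.
Qed.

(** * Computable model of the Petersen graph *)

Definition vcode : Type := (nat * nat)%type.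
Definition ecode : Type := (vcode * vcode)%type.

Definition vcodes : seq vcode :=
  [seq p <- [seq (a, b) | a <- iota 0 5, b <- iota 0 5] | p.1 < p.2].

Definition vadj (x y : vcode) : bool :=
  [&& x.1 != y.1, x.1 != y.2, x.2 != y.1 & x.2 != y.2].

(* Adjacent vertices are disjoint pairs, so comparing their least elements    *)
(* selects one orientation of each edge.                                      *)
Definition ecodes : seq ecode :=
  [seq e <- [seq (x, y) | x <- vcodes, y <- vcodes] | vadj e.1 e.2 && (e.1.1 < e.2.1)].

(* The edges listed for P_2_2 and P_3_2 alternate in the hexagon              *)
(* 02, 13, 04, 12, 03, 14; those for P_2_3 and P_3_3 are edges whose four     *)
(* points miss 4, and edges missing the same point are pairwise at distance 3.*)
Definition canon (t : petersen_type) : seq ecode :=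
  match t with
  | PlusP => [::]
  | P_1 => [:: ((0, 2), (1, 3))]
  | P_2_2 => [:: ((0, 2), (1, 3)); ((0, 4), (1, 2))]
  | P_3_2 => [:: ((0, 2), (1, 3)); ((0, 4), (1, 2)); ((0, 3), (1, 4))]
  | P_2_3 => [:: ((0, 1), (2, 3)); ((0, 2), (1, 3))]
  | P_3_3 => [:: ((0, 1), (2, 3)); ((0, 2), (1, 3)); ((0, 3), (1, 2))]
  end.

Definition types := [:: PlusP; P_1; P_2_2; P_3_2; P_2_3; P_3_3].

Definition perms := permutations (iota 0 5).

Definition vperm (p : seq nat) (x : vcode) : vcode :=
  let a := nth 0 p x.1 in let b := nth 0 p x.2 in if a < b then (a, b) else (b, a).

Definition enorm (e : ecode) : ecode := if e.1.1 < e.2.1 then e else (e.2, e.1).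

Definition eperm p (e : ecode) : ecode := enorm (vperm p e.1, vperm p e.2).

(** Only one inclusion is tested: a vertex permutation acts injectively on edges, so with equal
    sizes the image of [N] is all of [canon t]. *)
Definition orbit_canon (t : petersen_type) (N : seq ecode) : bool :=
  [&& uniq N, all (fun e => e \in ecodes) N, size N == size (canon t) &
      has (fun p => all (fun e => eperm p e \in canon t) N) perms].

Definition cut (X : seq vcode) : seq ecode :=
  [seq e <- ecodes | (e.1 \in X) (+) (e.2 \in X)].

Fixpoint paths (n : nat) : seq (seq vcode) :=
  if n is n'.+1 then
    [seq x :: s | s <- paths n',
       x <- [seq x <- vcodes | (x \notin s) && (if s is y :: _ then vadj x y else true)]]
  else [:: [::]].

Definition cycles (n : nat) : seq (seq vcode) :=
  [seq c <- paths n | vadj (head (0, 0) c) (last (0, 0) c)].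

Definition exceeds (N : seq ecode) (X : seq ecode) : bool :=
  size X < 2 * count (fun e => e \in N) X.

(* Enlarging [N] preserves [exceeds], so a branch can be cut off as soon as   *)
(* some cut is exceeded.  A conditional replaces [||], which [vm_compute]     *)
(* would not short-circuit.                                                   *)
Fixpoint search (cuts : seq (seq ecode)) (N rest : seq ecode) : bool :=
  if has (exceeds N) cuts then true else
  if rest is e :: rest' then search cuts N rest' && search cuts (e :: N) rest'
  else has (fun t => orbit_canon t N) types.

Lemma card_pair01 : #|[set ord0; ord_max] : {set 'I_5}| == 2.
Proof. by rewrite cards2. Qed.

(** The default of [insubd] is never reached on [vcodes], whose entries are pairs of distinct
    numbers below 5. *)
Definition pv (x : vcode) : petersen :=
  insubd (exist (fun A : {set 'I_5} => #|A| == 2) _ card_pair01) [set inord x.1; inord x.2].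

Lemma vcodesP (x : vcode) : reflect (x.1 < x.2 < 5) (x \in vcodes).
Proof.
rewrite mem_filter; apply: (iffP andP) => [[lt /allpairsP[[a b] [_]]]|/andP[lt lt5]].
  by rewrite mem_iota => /= b5 ex; rewrite lt ex.
split=> //; apply/allpairsP; exists x; rewrite !mem_iota /= lt5 (ltn_trans lt lt5).
by case: x lt lt5.
Qed.

Lemma val_pv x : x \in vcodes -> val (pv x) = [set inord x.1; inord x.2].
Proof.
move=> /vcodesP/andP[lt lt5]; apply: insubdK.
by rewrite unfold_in cards2 -val_eqE /= !inordK ?(ltn_trans lt) // (ltn_eqF lt).
Qed.

Lemma pv_surj (A : petersen) : exists2 x, x \in vcodes & A = pv x.
Proof.
have /cards2P[i [j [neq_ij eqA]]] := valP A.
wlog lt_ij : i j neq_ij eqA / i < j => [thm|].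
  have [lt|] := ltnP i j; first exact: thm lt.
  rewrite leq_eqVlt val_eqE eq_sym (negbTE neq_ij) /= => lt.
  by apply: (thm j i); rewrite // 1?eq_sym // eqA setUC.
have Vx : (i : nat, j : nat) \in vcodes by apply/vcodesP; rewrite lt_ij /=.
by exists (i : nat, j : nat) => //; apply: val_inj; rewrite val_pv //= !inord_val.
Qed.

Lemma petersenP (P : petersen -> Prop) :
  (forall x, x \in vcodes -> P (pv x)) -> forall A, P A.
Proof. by move=> PV A; have [x /PV + ->] := pv_surj A. Qed.

Lemma adj_pv : {in vcodes &, forall x y, adj (pv x) (pv y) = vadj x y}.
Proof.
move=> x y Vx Vy; rewrite /= /petersen_adj !val_pv //.
rewrite -setI_eq0 setIUl setU_eq0 !setI_eq0 !disjoints1 !inE !negb_or.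
move: Vx Vy => /vcodesP/andP[lx x5] /vcodesP/andP[ly y5].
by rewrite -!val_eqE /= !inordK ?(ltn_trans lx x5) ?(ltn_trans ly y5) // -andbA.
Qed.

(** Petersen vertices are determined by their neighbourhoods. Hence any map preserving and
    reflecting adjacency is injective, which serves both for [pv] and for the action of
    permutations. *)
Lemma vadj_sep : {in vcodes &, forall x y, {in vcodes, vadj x =1 vadj y} -> x = y}.
Proof.
have sep : all (fun x => all (fun y =>
    all (fun z => vadj x z == vadj y z) vcodes ==> (x == y)) vcodes) vcodes.
  by vm_compute.
move=> x y Vx Vy adj_xy; apply/eqP; move: (allP (allP sep x Vx) y Vy) => /implyP; apply.
by apply/allP => z Vz; rewrite adj_xy.
Qed.

Lemma pv_inj : {in vcodes &, injective pv}.
Proof.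
by move=> x y Vx Vy eq_xy; apply: vadj_sep => // z Vz; rewrite -!adj_pv // eq_xy.
Qed.

Lemma petersen_adj_inj (A B : petersen) : adj A =1 adj B -> A = B.
Proof.
have [x Vx ->] := pv_surj A; have [y Vy ->] := pv_surj B => adj_xy.
by congr pv; apply: vadj_sep => // z Vz; rewrite -!adj_pv.
Qed.

Definition pe (e : ecode) : {set petersen} := [set pv e.1; pv e.2].

Lemma ecodesP (e : ecode) :
  reflect [/\ e.1 \in vcodes, e.2 \in vcodes, vadj e.1 e.2 & e.1.1 < e.2.1]
          (e \in ecodes).
Proof.
rewrite [e \in ecodes]mem_filter; apply: (iffP andP) 
  => [[/andP[adj_e lt] /allpairsP[[x y] /= [Vx Vy ee]]]|].
  by rewrite ee in adj_e lt *.
case=> V1 V2 -> ->; split=> //; apply/allpairsP; exists e; split=> //.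
by case: (e).
Qed.

Lemma pe_enorm e : pe (enorm e) = pe e.
Proof. by rewrite /enorm; case: ifP => //; rewrite /pe /= setUC. Qed.

Lemma vadjC x y : vadj x y = vadj y x.
Proof.
by rewrite /vadj !(eq_sym y.1) !(eq_sym y.2); congr (_ && _); rewrite andbCA.
Qed.

Lemma enorm_ecodes (e : ecode) :
  e.1 \in vcodes -> e.2 \in vcodes -> vadj e.1 e.2 -> enorm e \in ecodes.
Proof.
move=> V1 V2 adj_e; apply/ecodesP; rewrite /enorm; case: ltnP => //= le.
rewrite vadjC; split=> //; rewrite ltn_neqAle le andbT.
by case/and4P: adj_e; rewrite eq_sym.
Qed.

(** Codes with the same endpoints agree up to reversal, and the orientation by least elements
    excludes a reversal. *)
Lemma pe_inj : {in ecodes &, injective pe}.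
Proof.
move=> e f /ecodesP[e1 e2 adj_e lt_e] /ecodesP[f1 f2 adj_f lt_f] eq_ef.
have nxx x : vadj x x = false by rewrite /vadj eqxx.
have: pv e.1 \in pe f by rewrite -eq_ef set21.
have: pv e.2 \in pe f by rewrite -eq_ef set22.
rewrite !inE !(inj_in_eq pv_inj) // {eq_ef}.
move=> /orP[]/eqP e2f /orP[]/eqP e1f; rewrite e1f e2f ?nxx // in adj_e lt_e.
  by rewrite ltnNge ltnW in lt_e.
by case: e f e1f e2f {e1 e2 f1 f2 adj_e adj_f lt_e lt_f} => [x y] [z w] /= -> ->.
Qed.

Lemma edges_petersenP (e : {set petersen}) :
  reflect (exists2 c, c \in ecodes & e = pe c) (e \in edges petersen).
Proof.
apply: (iffP (edgesP e)) => [[x [y [xy ->]]]|[c /ecodesP[V1 V2 adj_c _] ->]]; last first.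
  by exists (pv c.1), (pv c.2); rewrite adj_pv.
move: xy; have [x' Vx ->] := pv_surj x; have [y' Vy ->] := pv_surj y.
rewrite adj_pv // => xy; exists (enorm (x', y')); first exact: enorm_ecodes.
by rewrite pe_enorm.
Qed.

Lemma neg_edges_petersen sigma :
  neg_edges (signed_petersen sigma) = [set e in map pe (filter (sigma \o pe) ecodes)].
Proof.
apply/setP => e; rewrite !inE; apply/andP/mapP => [[/edges_petersenP[c Ec ->]]|].
  by exists c; rewrite // mem_filter /= Ec andbT.
case=> c; rewrite mem_filter /= => /andP[neg_c Ec] ->; split=> //.
by apply/edges_petersenP; exists c.
Qed.

Lemma card_codes (N : seq ecode) :
  uniq N -> {subset N <= ecodes} -> #|[set e in map pe N]| = size N.
Proof.
move=> UN sN; rewrite cardsE; have /card_uniqP -> : uniq (map pe N).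
  by rewrite map_inj_in_uniq // => e f /sN Ee /sN; apply: pe_inj.
by rewrite size_map.
Qed.

Lemma card_neg_petersen sigma :
  #|neg_edges (signed_petersen sigma)| = count (sigma \o pe) ecodes.
Proof.
rewrite neg_edges_petersen card_codes ?size_filter ?filter_uniq //.
by move=> e; rewrite mem_filter => /andP[].
Qed.

Definition code (A : petersen) : vcode := nth (0, 1) vcodes (index A (map pv vcodes)).

Lemma pvK : {in vcodes, cancel pv code}.
Proof.
move=> x Vx; have xi : pv x \in map pv vcodes by apply: map_f.
apply: pv_inj => //; first by rewrite mem_nth // -(size_map pv) index_mem.
by rewrite -(nth_map _ (pv x)) ?nth_index // -(size_map pv) index_mem.
Qed.

(** * The action of S_5 and the canonical representatives *)

Lemma perms_adj p : p \in perms ->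
  {in vcodes &, forall x y, [/\ vperm p x \in vcodes, vperm p y \in vcodes
                              & vadj (vperm p x) (vperm p y) = vadj x y]}.
Proof.
have ok : all (fun p => all (fun x => (vperm p x \in vcodes) &&
    all (fun y => vadj (vperm p x) (vperm p y) == vadj x y) vcodes) vcodes) perms.
  by vm_compute.
move=> perm_p x y Vx Vy; have /allP okp := allP ok p perm_p.
have /andP[px /allP/(_ y Vy)/eqP eq_adj] := okp x Vx.
have /andP[py _] := okp y Vy.
by split.
Qed.

Definition petersen_perm (p : seq nat) (A : petersen) : petersen := pv (vperm p (code A)).

Lemma petersen_perm_adj p : p \in perms ->
  forall A B, adj (petersen_perm p A) (petersen_perm p B) = adj A B.
Proof.
move=> perm_p; apply: petersenP => x Vx; apply: petersenP => y Vy.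
by have [? ? eq_adj] := perms_adj perm_p Vx Vy; rewrite /petersen_perm !pvK // !adj_pv.
Qed.

Lemma petersen_perm_bij p : p \in perms -> bijective (petersen_perm p).
Proof.
move=> perm_p; apply: injF_bij => A B eqAB; apply: petersen_adj_inj => D.
by rewrite -(petersen_perm_adj perm_p A) eqAB petersen_perm_adj.
Qed.

Lemma petersen_perm_pe p : p \in perms ->
  {in ecodes, forall e, [/\ eperm p e \in ecodes & petersen_perm p @: pe e = pe (eperm p e)]}.
Proof.
move=> perm_p e /ecodesP[V1 V2 adj_e _]; have [? ? eq_adj] := perms_adj perm_p V1 V2.
split; first by rewrite enorm_ecodes /= ?eq_adj.
by rewrite imset_pair pe_enorm /petersen_perm !pvK.
Qed.

Definition canon_sgn (t : petersen_type) (e : {set petersen}) : bool := e \in map pe (canon t).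

Definition canon_graph (t : petersen_type) : signed_graph := signed_petersen (canon_sgn t).

Lemma canon_sub t : {subset canon t <= ecodes}.
Proof. by apply/allP; case: t; vm_compute. Qed.

Lemma canon_uniq t : uniq (canon t).
Proof. by case: t. Qed.

Lemma canon_neg t : neg_edges (canon_graph t) = [set e in map pe (canon t)].
Proof.
apply/setP => e; rewrite !inE andb_idl // => /mapP[c /canon_sub Ec ->].
by apply/edges_petersenP; exists c.
Qed.

Lemma canon_sgnE t e : e \in ecodes -> canon_sgn t (pe e) = (e \in canon t).
Proof.
move=> Ee; apply/mapP/idP => [[f Cf eq_ef]|]; last by exists e.
by rewrite (pe_inj Ee _ eq_ef) // (canon_sub Cf).
Qed.

Lemma canon_card t : #|neg_edges (canon_graph t)| = size (canon t).
Proof. by rewrite canon_neg card_codes ?canon_uniq //; apply: canon_sub. Qed.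

Lemma orbit_isomorphic t N sigma :
  neg_edges (signed_petersen sigma) = [set e in map pe N] -> orbit_canon t N ->
  isomorphic (signed_petersen sigma) (canon_graph t).
Proof.
move=> negN /and4P[UN /allP sN /eqP sizeN /hasP[p perm_p /allP imN]].
have fadj := petersen_perm_adj perm_p; have fB := petersen_perm_bij perm_p.
have FI := imset_inj (bij_inj fB).
exists (petersen_perm p); split=> // x y xy.
have im_neg : [set petersen_perm p @: e | e : {set petersen} in [set e in map pe N]]
            = neg_edges (canon_graph t).
  (* The image of [N] lies in the canonical set and has the same cardinality, so the two are
     equal. *)
  apply/eqP; rewrite eqEcard card_imset // canon_card card_codes // sizeN leqnn andbT canon_neg.
  apply/subsetP => _ /imsetP[_ /[!inE] /mapP[c Nc ->] ->].
  have [Ec ->] := petersen_perm_pe perm_p (sN c Nc).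
  by rewrite map_f // imN.
have -> : sgn (s := signed_petersen sigma) [set x; y]
        = ([set x; y] \in neg_edges (signed_petersen sigma)).
  by rewrite inE in_edges xy.
rewrite negN -(mem_imset _ _ FI) im_neg inE imset_pair in_edges fadj xy.
by [].
Qed.

Lemma neg_petersen_codes sigma : exists2 N : seq ecode,
  [/\ uniq N, {subset N <= ecodes} & size N = #|neg_edges (signed_petersen sigma)|]
  & neg_edges (signed_petersen sigma) = [set e in map pe N].
Proof.
exists (filter (sigma \o pe) ecodes); last exact: neg_edges_petersen.
split; rewrite ?filter_uniq // ?size_filter ?card_neg_petersen //.
by move=> e; rewrite mem_filter => /andP[].
Qed.

(** * Distances in the line graph *)

Definition ladj (e f : ecode) : bool :=
  (e != f) && [|| e.1 == f.1, e.1 == f.2, e.2 == f.1 | e.2 == f.2].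

Lemma line_adj_pe : {in ecodes &, forall e f, line_adj (pe e) (pe f) = ladj e f}.
Proof.
move=> e f Ee Ef; have peE (g : ecode) : g \in ecodes -> pe g \in edges petersen.
  by move=> Eg; apply/edges_petersenP; exists g.
rewrite /line_adj !peE //= (inj_in_eq pe_inj) //; congr (_ && _).
move: Ee Ef => /ecodesP[e1 e2 _ _] /ecodesP[f1 f2 _ _].
rewrite setIUl setU_eq0 !setI_eq0 !disjoints1 !inE !(inj_in_eq pv_inj) //.
by rewrite negb_and !negbK -orbA.
Qed.

Lemma distance2P (V : finType) (r : rel V) x y : symmetric r -> x != y ->
  distance r x y 2 <-> ~~ r x y /\ exists2 z, r x z & r z y.
Proof.
move=> symr neq_xy; split=> [[[[|z [|w [|? ?]]] [] //= /and3P[xz zw _] wy _]] minp|].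
  subst w; split; last by exists z.
  by apply/negP => xy; have := minp [:: y]; rewrite /= xy => /(_ isT erefl).
case=> nxy [z xz zy]; split; first by exists [:: z; y]; rewrite /= xz zy.
move=> [|a [|b p]] //= => [_ eq_xy|/andP[xa _] ay].
  by rewrite eq_xy eqxx in neq_xy.
by rewrite -ay xa in nxy.
Qed.

(** Minimality of a walk of length 3 means that no walk of length 0, 1 or 2 joins the ends; this
    leaves only bounded quantifiers, hence a computable test. *)
Lemma distance3P (V : finType) (r : rel V) x y : symmetric r -> x != y ->
  distance r x y 3 <->
  [/\ ~~ r x y, forall z, r x z -> ~~ r z y & exists z w, [/\ r x z, r z w & r w y]].
Proof.
move=> symr neq_xy; split=> [[[[|z [|w [|v [|? ?]]]] [] //= /and4P[xz zw wv _] vy _]] minp|].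
  subst v; split; last by exists z, w.
    by apply/negP => xy; have := minp [:: y]; rewrite /= xy => /(_ isT erefl).
  move=> a xa; apply/negP => ay.
  by have := minp [:: a; y]; rewrite /= xa ay => /(_ isT erefl).
case=> nxy nxzy [z [w [xz zw wy]]]; split; first by exists [:: z; w; y]; rewrite /= xz zw wy.
move=> [|a [|b [|c p]]] //= => [_ eq_xy|/andP[xa _] ay|/and3P[xa ab _] bY].
- by rewrite eq_xy eqxx in neq_xy.
- by rewrite -ay xa in nxy.
- by rewrite bY in ab; have := nxzy a xa; rewrite ab.
Qed.

Definition ladj2 (e f : ecode) : bool :=
  ~~ ladj e f && has (fun g => ladj e g && ladj g f) ecodes.

Definition ladj3 (e f : ecode) : bool :=
  [&& ~~ ladj e f, ~~ has (fun g => ladj e g && ladj g f) ecodes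
    & has (fun g => has (fun h => [&& ladj e g, ladj g h & ladj h f]) ecodes) ecodes].

Lemma line_adj_edges (e f : {set petersen}) :
  line_adj e f ->
  (exists2 c, c \in ecodes & e = pe c) /\ (exists2 c, c \in ecodes & f = pe c).
Proof. by case/and4P => /edges_petersenP ? /edges_petersenP. Qed.

Lemma has_ladj2 (e f : ecode) : e \in ecodes -> f \in ecodes ->
  reflect (exists2 z, line_adj (pe e) z & line_adj z (pe f))
          (has (fun g => ladj e g && ladj g f) ecodes).
Proof.
move=> Ee Ef; apply: (iffP hasP) => [[g Eg /andP[eg gf]]|[z ez zf]].
  by exists (pe g); rewrite line_adj_pe.
have [_ [g Eg eqz]] := line_adj_edges ez.
by exists g => //; rewrite -!line_adj_pe // -eqz ez.
Qed.

Lemma line_adj_sym (G : sgraph) : symmetric (@line_adj G).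
Proof. by move=> e f; rewrite /line_adj andbCA eq_sym setIC. Qed.

Lemma edge_distance2 (e f : ecode) : e \in ecodes -> f \in ecodes -> e != f ->
  edge_distance (pe e) (pe f) 2 <-> ladj2 e f.
Proof.
move=> Ee Ef neq_ef; have neq_pe : pe e != pe f by rewrite (inj_in_eq pe_inj).
apply: iff_trans (distance2P (@line_adj_sym petersen) neq_pe) _.
rewrite line_adj_pe // /ladj2; split=> [[-> /has_ladj2 -> //]|/andP[nef /has_ladj2 []]] //.
by split=> //; exists x.
Qed.

Lemma edge_distance3 (e f : ecode) : e \in ecodes -> f \in ecodes -> e != f ->
  edge_distance (pe e) (pe f) 3 <-> ladj3 e f.
Proof.
move=> Ee Ef neq_ef; have neq_pe : pe e != pe f by rewrite (inj_in_eq pe_inj).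
apply: iff_trans (distance3P (@line_adj_sym petersen) neq_pe) _.
rewrite line_adj_pe // /ladj3; split=> [[-> no2 [z [w [ez zw wf]]]]|].
  rewrite andTb; apply/andP; split; first by apply/(has_ladj2 Ee Ef) => -[a ea]; apply/negP/no2.
  have [_ [g Eg eqz]] := line_adj_edges ez; have [_ [h Eh eqw]] := line_adj_edges zw.
  apply/hasP; exists g => //; apply/hasP; exists h => //.
  by rewrite -!line_adj_pe // -eqz -eqw ez zw.
case/and3P=> -> /(has_ladj2 Ee Ef) no2 /hasP[g Eg /hasP[h Eh /and3P[eg gh hf]]].
split=> // [z ez|]; last by exists (pe g), (pe h); rewrite !line_adj_pe.
by apply/negP => zf; apply: no2 => //; exists z.
Qed.

(** * The six types up to isomorphism *)

Definition cycle_code (c : seq vcode) : bool :=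
  [&& 2 < size c, cycle vadj c & uniq c].

Lemma cycle_edges_in (T : eqType) (c : seq T) p :
  p \in cycle_edges c -> p.1 \in c /\ p.2 \in c.
Proof.
move=> cp; have := map_f snd cp; have := map_f fst cp.
by rewrite -/(unzip1 _) -/(unzip2 _) unzip1_zip ?unzip2_zip ?size_rot // mem_rot.
Qed.

Lemma is_cycle_pv (c : seq vcode) : {subset c <= vcodes} ->
  is_cycle (map pv c : seq petersen) = cycle_code c.
Proof.
move=> sV; rewrite /is_cycle /ucycleb /cycle_code size_map map_inj_in_uniq; last first.
  by move=> x y /sV Vx /sV; apply: pv_inj.
congr [&& _, _ & _].
rewrite !cycle_all cycle_edges_map all_map; apply: eq_in_all => -[x y] xy.
have [/= cx cy] := cycle_edges_in xy.
by rewrite -[LHS]/(adj (pv x) (pv y)) adj_pv ?sV.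
Qed.

Lemma cycle_edges_code (c : seq vcode) : {subset c <= vcodes} -> cycle_code c ->
  forall e, e \in cycle_edges c -> enorm e \in ecodes.
Proof.
move=> sV /and3P[_ + _] e ce; rewrite cycle_all => /allP/(_ e ce) adj_e.
by have [? ?] := cycle_edges_in ce; rewrite enorm_ecodes ?sV.
Qed.

Definition canon_cycle_sgn (t : petersen_type) (c : seq vcode) : bool :=
  foldr (fun e b => (enorm e \in canon t) (+) b) false (cycle_edges c).

Lemma cycle_sgn_canon t (c : seq vcode) : {subset c <= vcodes} -> cycle_code c ->
  cycle_sgn (S := canon_graph t) (map pv c) = canon_cycle_sgn t c.
Proof.
move=> sV cyc; have Ec := cycle_edges_code sV cyc.
have /and3P[_ _ Uc] : is_cycle (map pv c : seq petersen) by rewrite is_cycle_pv.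
rewrite /cycle_sgn (big_next _ _ (fun x y => canon_sgn t [set x; y])) //.
rewrite cycle_edges_map big_map /canon_cycle_sgn.
elim: (cycle_edges c) Ec => [|e s IH] Es; first by rewrite big_nil.
rewrite big_cons /= -IH => [|f sf]; last by rewrite Es // inE sf orbT.
by rewrite -(canon_sgnE t (Es e (mem_head _ _))) pe_enorm.
Qed.

Lemma paths_mem (c : seq vcode) : {subset c <= vcodes} -> uniq c ->
  (if c is x :: s then path vadj x s else true) -> c \in paths (size c).
Proof.
elim: c => [|x s IH] sV; first by rewrite inE.
rewrite cons_uniq => /andP[nsx Us] px; apply/allpairsPdep; exists s, x; split=> //.
  apply: IH => // [y sy|]; first by rewrite sV // inE sy orbT.
  by case: s px {nsx Us sV} => //= y s /andP[].
rewrite mem_filter nsx sV ?mem_head // andbT /=.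
by case: s px {IH nsx Us sV} => //= y s /andP[].
Qed.

Lemma cycles_mem (c : seq vcode) : {subset c <= vcodes} -> cycle_code c ->
  c \in cycles (size c).
Proof.
move=> sV /and3P[lt2 cyc Uc]; case: c => // x s in sV lt2 cyc Uc *.
move: cyc; rewrite /= rcons_path => /andP[px lx].
by rewrite mem_filter paths_mem //= andbT vadjC.
Qed.

Lemma canon_has_type t : has_type t (canon_graph t).
Proof.
have dist (d : rel ecode) k s : all (fun e => all (fun f => (e != f) ==> d e f) s) s ->
    {subset s <= ecodes} ->
    {in ecodes &, forall e f, e != f -> edge_distance (pe e) (pe f) k <-> d e f} ->
    {in [set e in map pe s] &, forall e f, e != f -> edge_distance e f k}.
  move=> /allP ds sE dk _ _ /[!inE] /mapP[e se ->] /mapP[f sf ->] neq.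
  have {}neq : e != f by apply: contraNneq neq => ->.
  by apply/dk => //; rewrite ?sE //; have /allP/(_ f sf)/implyP := ds e se; apply.
have D2 := fun e f Ee Ef => @edge_distance2 e f Ee Ef.
have D3 := fun e f Ee Ef => @edge_distance3 e f Ee Ef.
have neg := canon_neg t; have card := canon_card t.
case: t neg card => neg card /=.
- by rewrite neg; apply/setP => e; rewrite !inE.
- exact: card.
- by split; rewrite // neg; apply: dist D2; [vm_compute|apply: canon_sub].
- exists (pv (0, 2)), (pv (1, 3)), (pv (0, 4)), (pv (1, 2)), (pv (0, 3)), (pv (1, 4)).
  split; last by rewrite neg; apply/setP => e; rewrite !inE -!orbA.
  rewrite -[[:: _; _; _; _; _; _]]/(map pv [:: (0, 2); (1, 3); (0, 4); (1, 2); (0, 3); (1, 4)]).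
  by rewrite is_cycle_pv //; apply/allP.
- by split; rewrite // neg; apply: dist D3; [vm_compute|apply: canon_sub].
- by split; rewrite // neg; apply: dist D3; [vm_compute|apply: canon_sub].
Qed.

Lemma orbit_edge : {in ecodes, forall e, orbit_canon P_1 [:: e]}.
Proof. by apply/allP; vm_compute. Qed.

Lemma orbit_pair2 :
  {in ecodes &, forall e f, e != f -> ladj2 e f -> orbit_canon P_2_2 [:: e; f]}.
Proof.
have ok : all (fun e => all (fun f => orbit_canon P_2_2 [:: e; f])
    [seq f <- ecodes | (e != f) && ladj2 e f]) ecodes by vm_compute.
move=> e f Ee Ef neq adj2; apply: (allP (allP ok e Ee)).
by rewrite mem_filter neq adj2 Ef.
Qed.

Lemma orbit_pair3 :
  {in ecodes &, forall e f, e != f -> ladj3 e f -> orbit_canon P_2_3 [:: e; f]}.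
Proof.
have ok : all (fun e => all (fun f => orbit_canon P_2_3 [:: e; f])
    [seq f <- ecodes | (e != f) && ladj3 e f]) ecodes by vm_compute.
move=> e f Ee Ef neq adj3; apply: (allP (allP ok e Ee)).
by rewrite mem_filter neq adj3 Ef.
Qed.

Lemma orbit_triple3 : {in ecodes & &, forall e f g,
  e != f -> e != g -> f != g -> ladj3 e f -> ladj3 e g -> ladj3 f g ->
  orbit_canon P_3_3 [:: e; f; g]}.
Proof.
have ok : all (fun e => all (fun f => all (fun g => orbit_canon P_3_3 [:: e; f; g])
    [seq g <- ecodes | [&& e != g, f != g, ladj3 e g & ladj3 f g]])
    [seq f <- ecodes | (e != f) && ladj3 e f]) ecodes by vm_compute.
move=> e f g Ee Ef Eg neq_ef neq_eg neq_fg ef eg fg.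
apply: (allP (allP (allP ok e Ee) f _)); first by rewrite mem_filter neq_ef ef Ef.
by rewrite mem_filter neq_eg neq_fg eg fg Eg.
Qed.

(** [cycles 6] lists each hexagon from every starting vertex and in both directions, so both of its
    alternating triples are checked. *)
Lemma orbit_hexagon a b c d e f : [:: a; b; c; d; e; f] \in cycles 6 ->
  orbit_canon P_3_2 [:: enorm (a, b); enorm (c, d); enorm (e, f)].
Proof.
have ok : all (fun c => orbit_canon P_3_2 (map enorm
    (if c is [:: u; v; w; x; y; z] then [:: (u, v); (w, x); (y, z)] else [::]))) (cycles 6).
  by vm_compute.
by move/(allP ok).
Qed.

Lemma neg_pair_isomorphic t d (r : rel ecode) sigma :
  {in ecodes &, forall e f, e != f -> edge_distance (pe e) (pe f) d <-> r e f} ->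
  {in ecodes &, forall e f, e != f -> r e f -> orbit_canon t [:: e; f]} ->
  neg_at_distance 2 d (signed_petersen sigma) ->
  isomorphic (signed_petersen sigma) (canon_graph t).
Proof.
move=> dr orbit [card2 dist].
have [N [UN sN sizeN] negN] := neg_petersen_codes sigma.
apply: (orbit_isomorphic negN); rewrite card2 in sizeN.
case: N sizeN UN sN negN => [|e [|f [|]]] // _ /andP[] /[!inE] neq_ef _.
move=> /allP /and3P[Ee Ef _] negN.
apply: orbit => //; apply/dr => //; apply: dist.
- by rewrite negN !inE eqxx.
- by rewrite negN !inE eqxx orbT.
- by rewrite (inj_in_eq pe_inj).
Qed.

(** S_5 is transitive on edges, on pairs of edges at distance 2, on pairs at distance 3, on triples
    pairwise at distance 3, and on alternating triples of hexagons. *)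
Lemma has_type_canon t sigma : has_type t (signed_petersen sigma) ->
  isomorphic (signed_petersen sigma) (canon_graph t).
Proof.
have [N [UN sN sizeN] negN] := neg_petersen_codes sigma.
case: t => /= [neg0|card1||[a0 [b0 [c0 [d0 [e0 [f0 [cyc neg]]]]]]]||[card3 dist]].
- apply: (orbit_isomorphic (t := PlusP) negN).
  by have /size0nil -> : size N = 0 by rewrite sizeN neg0 cards0.
- apply: (orbit_isomorphic (t := P_1) negN); rewrite card1 in sizeN.
  case: N sizeN sN {UN negN} => [|e [|]] // _ sN.
  by apply/orbit_edge/sN/mem_head.
- exact: neg_pair_isomorphic edge_distance2 orbit_pair2.
- have [a Va ?] := pv_surj a0; have [b Vb ?] := pv_surj b0; have [c Vc ?] := pv_surj c0.
  have [d Vd ?] := pv_surj d0; have [e Ve ?] := pv_surj e0; have [f Vf ?] := pv_surj f0.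
  subst a0 b0 c0 d0 e0 f0; have sV : {subset [:: a; b; c; d; e; f] <= vcodes}.
    by apply/allP; rewrite /all Va Vb Vc Vd Ve Vf.
  have {}cyc : cycle_code [:: a; b; c; d; e; f] by rewrite -is_cycle_pv.
  apply: orbit_isomorphic (orbit_hexagon (cycles_mem sV cyc)).
  by rewrite neg; apply/setP => g; rewrite /= !inE !pe_enorm -!orbA.
- exact: neg_pair_isomorphic edge_distance3 orbit_pair3.
- apply: (orbit_isomorphic (t := P_3_3) negN); rewrite card3 in sizeN.
  have far (e f : ecode) : e \in N -> f \in N -> e != f -> ladj3 e f.
    move=> Ne Nf neq_ef; apply/(edge_distance3 (sN e Ne) (sN f Nf) neq_ef).
    have neg (g : ecode) : g \in N -> pe g \in neg_edges (signed_petersen sigma).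
      by move=> Ng; rewrite negN inE map_f.
    by apply: dist; rewrite ?neg // (inj_in_eq pe_inj) ?sN.
  case: N sizeN UN sN far {negN} => [|e [|f [|g [|]]]] // _.
  rewrite [uniq _]/= !inE negb_or => /and3P[/andP[neq_ef neq_eg] neq_fg _].
  move=> /allP /and4P[Ee Ef Eg _] far.
  by apply: orbit_triple3 => //; apply: far => //; rewrite !inE eqxx ?orbT.
Qed.

(** * Minimality and frustration indices *)

Lemma exceeds_sub (N M X : seq ecode) : {subset N <= M} -> exceeds N X -> exceeds M X.
Proof.
move=> sNM /leq_trans; apply; rewrite leq_mul2l /=.
exact: sub_count.
Qed.

(** Deciding each edge by [a] follows a single branch of the search tree. That branch is never
    pruned, since a cut exceeded by a partial set is exceeded by the final one, so it ends in a
    successful orbit test. *)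
Lemma searchP cuts (a : pred ecode) rest N :
  search cuts N rest ->
  {in cuts, forall X, ~~ exceeds (catrev (filter a rest) N) X} ->
  exists t, orbit_canon t (catrev (filter a rest) N).
Proof.
elim: rest N => [|e rest IH] N /=;
  case: (boolP (has _ cuts)) => [/hasP[X cX exc] _|_ good] noexc.
- by have := noexc X cX; rewrite exc.
- have /(has_nthP PlusP)[i _] : has (orbit_canon^~ N) types := good.
  by exists (nth PlusP types i).
- have := noexc X cX; rewrite (exceeds_sub _ exc) // => f Nf.
  by rewrite catrevE mem_cat Nf orbT.
- by case/andP: good noexc; case: ifP => _ good1 good2 noexc; apply: IH.
Qed.

Lemma count_addb (T : Type) (a b : pred T) s :
  count (fun x => a x (+) b x) s + 2 * count (fun x => b x && a x) s = count a s + count b s.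
Proof.
elim: s => //= x s IH; rewrite mulnDr addnACA IH [RHS]addnACA; congr (_ + _).
by case: (a x); case: (b x).
Qed.

Lemma count_mem_filter (T : eqType) (a b : pred T) s :
  count (fun x => x \in filter a s) (filter b s) = count (fun x => b x && a x) s.
Proof.
by rewrite count_filter; apply: eq_in_count => x sx /=; rewrite mem_filter sx andbT andbC.
Qed.

(** Let N be the set of negative edges and C the cut of [Y]. Switching [Y] replaces N by its
    symmetric difference with C, of size |N| + |C| - 2|N ∩ C|. Minimality makes this at least |N|,
    so 2|N ∩ C| <= |C|. *)
Lemma minimal_cut sigma Y : minimal (signed_petersen sigma) ->
  ~~ exceeds (filter (sigma \o pe) ecodes) (cut Y).
Proof.
move=> min_s; pose zeta (A : petersen) := code A \in Y.
have := minimal_switch (S := signed_petersen sigma) zeta min_s.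
rewrite card_neg_petersen (@card_neg_petersen (@sgn (switch (S := signed_petersen sigma) zeta))).
rewrite -leqNgt size_filter.
have -> : count (@sgn (switch (S := signed_petersen sigma) zeta) \o pe) ecodes =
  count (fun e => (sigma \o pe) e (+) ((e.1 \in Y) (+) (e.2 \in Y))) ecodes.
  apply: eq_in_count => e /ecodesP[V1 V2 adj_e _].
  rewrite /comp sgn_switch ?adj_pv // /zeta !pvK //.
  by rewrite addbAC addbC.
have := count_addb (sigma \o pe) (fun e => (e.1 \in Y) (+) (e.2 \in Y)) ecodes.
rewrite [count _ (cut Y)]count_mem_filter.
have arith a b c d : d + 2 * c = a + b -> a <= d -> 2 * c <= b.
  by move=> eq_ab le_ad; rewrite -(leq_add2l a) -eq_ab leq_add2r.
exact: arith.
Qed.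

Lemma minimal_canon sigma : minimal (signed_petersen sigma) ->
  exists t, isomorphic (signed_petersen sigma) (canon_graph t).
Proof.
(* [paths 1] gives the vertex cuts, of size 3, and [paths 3] the cuts around three-vertex paths, of
   size 5. *)
move=> min_s; pose cuts := map cut (paths 1 ++ paths 3).
have ok : search cuts [::] ecodes by vm_compute.
have [|t orb] := searchP (a := sigma \o pe) ok.
  move=> _ /mapP[Y _ ->]; apply: contra (minimal_cut Y min_s).
  by apply: exceeds_sub => e; rewrite catrevE cats0 mem_rev.
exists t; apply: orbit_isomorphic orb; rewrite neg_edges_petersen.
by apply/setP => e; rewrite !inE; apply/mapP/mapP => -[c];
  rewrite ?catrevE ?cats0 ?mem_rev => *; exists c; rewrite ?catrevE ?cats0 ?mem_rev.
Qed.

(** * Lower bounds for the frustration index *)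

Fixpoint unhit (m : nat) (cs : seq (seq vcode)) : bool :=
  (cs != [::]) &&
  if m is m'.+1 then
    all (fun e => unhit m' [seq c <- cs | e \notin map enorm (cycle_edges c)]) ecodes
  else true.

(** Induction on [m]: remove one edge from [D] and keep only the cycles avoiding it. [unhit] tries
    every such edge and asks that some cycle always remains. *)
Lemma unhitP m cs (D : {set {set petersen}}) :
  D \subset edges petersen -> #|D| <= m -> unhit m cs ->
  {in cs, forall c, {subset c <= vcodes} /\ cycle_code c} ->
  exists2 c, c \in cs & {in cycle_edges c, forall e, pe e \notin D}.
Proof.
elim: m cs D => [|m IH] cs D sDE cD.
  move: cD; rewrite leqn0 cards_eq0 => /eqP-> /=; rewrite andbT.
  by case: cs => // c cs _ _; exists c; rewrite ?mem_head // => e _; rewrite inE.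
case/andP=> ncs /allP hit good; have [D0|[d Dd]] := set_0Vmem D.
  case: cs ncs {hit good} => // c cs _; exists c; first exact: mem_head.
  by move=> e _; rewrite D0 inE.
have /edges_petersenP[g Eg eq_d] := subsetP sDE d Dd.
have [||c|c] := IH _ (D :\ d) _ _ (hit g Eg).
- exact: subset_trans (subsetDl _ _) sDE.
- by move: cD; rewrite (cardsD1 d) Dd.
- by rewrite mem_filter => /andP[_ /good].
rewrite mem_filter => /andP[nge cc] avoid; exists c => // e ce.
have := avoid e ce; rewrite !inE negb_and negbK => /orP[/eqP eq_ed|//].
have [sV cyc] := good c cc; case/mapP: nge; exists e => //.
by apply: pe_inj => //; rewrite ?(cycle_edges_code sV cyc) // pe_enorm eq_ed.
Qed.

Lemma cycles_good c : c \in cycles 5 ++ cycles 6 -> {subset c <= vcodes} /\ cycle_code c.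
Proof.
have ok : all (fun c => all (fun x => x \in vcodes) c && cycle_code c) (cycles 5 ++ cycles 6).
  by vm_compute.
by move/(allP ok) => /andP[/allP].
Qed.

Lemma canon_unhit t : 0 < size (canon t) ->
  unhit (size (canon t)).-1 (filter (canon_cycle_sgn t) (cycles 5 ++ cycles 6)).
Proof. by case: t => // _; vm_compute. Qed.

(** Deleting the negative edges gives the upper bound. A smaller [D] misses some negative pentagon
    or hexagon, which survives the deletion and contradicts balance. *)
Lemma canon_frustration t : frustration_index (canon_graph t) = size (canon t).
Proof.
apply/eqP; rewrite eqn_leq -{1}canon_card frustration_neg /=.
rewrite /frustration_index; case: ex_minnP => k /existsP[D /and3P[sDE /eqP cD balD]] _.
rewrite leqNgt; apply/negP => lt_k; have pos := leq_ltn_trans (leq0n k) lt_k.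
have cD' : #|D| <= (size (canon t)).-1 by rewrite cD -ltnS prednK.
have [c|c] := unhitP sDE cD' (canon_unhit pos).
  by rewrite mem_filter => /andP[_ /cycles_good].
rewrite mem_filter => /andP[neg cc] avoid; have [sV cyc] := cycles_good cc.
have cycD : is_cycle (map pv c : seq (delete (S := canon_graph t) D)).
  have := is_cycle_pv sV; rewrite cyc => /and3P[lt2 cyc' Uc]; apply/and3P; split=> //.
  move: cyc'; rewrite !cycle_all => /allP adj_c; apply/allP => p cp /=.
  rewrite /delete_adj; apply/andP; split; first exact: adj_c.
  by move: cp; rewrite cycle_edges_map => /mapP[e ce ->]; apply: avoid.
have /balancedP/(_ _ cycD) := balD.
rewrite -[LHS]/(cycle_sgn (S := canon_graph t) (map pv c)) cycle_sgn_canon //.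
by rewrite neg.
Qed.

(** * Separating the types by negative pentagons *)

Definition canon_pentagon_edge (t : petersen_type) : bool :=
  has (fun e => vadj e.1 e.2 &&
         all (fun c => (take 2 c == [:: e.1; e.2]) ==> canon_cycle_sgn t c) (cycles 5))
    [seq (x, y) | x <- vcodes, y <- vcodes].

Lemma canon_pentagon_edgeP t :
  has_negative_pentagon_edge (canon_graph t) <-> canon_pentagon_edge t.
Proof.
split=> [[A [B]]|/hasP[_ /allpairsP[[x y] [Vx Vy ->]] /andP[adj_xy /allP neg]]].
  have [x Vx ->] := pv_surj A; have [y Vy ->] := pv_surj B => -[adj_xy neg].
  rewrite adj_pv // in adj_xy; apply/hasP; exists (x, y).
    by apply/allpairsP; exists (x, y).
  rewrite adj_xy; apply/allP => c cc; apply/implyP => /eqP c_xy.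
  have size_c : size c = 5.
    have sizes : all (fun c => size c == 5) (cycles 5) by vm_compute.
    exact/eqP/(allP sizes c cc).
  have /cycles_good[sV cyc] : c \in cycles 5 ++ cycles 6.
    by rewrite mem_cat; apply/orP; left; exact: cc.
  case: c size_c c_xy sV cyc {cc} => [|x' [|y' [|u [|v [|w [|]]]]]] // _ [-> ->] sV cyc.
  rewrite -cycle_sgn_canon //; apply: neg.
  by rewrite -[[:: _; _; _; _; _]]/(map pv [:: x; y; u; v; w]) is_cycle_pv.
exists (pv x), (pv y); rewrite adj_pv //; split=> // A B D.
have [u Vu ->] := pv_surj A; have [v Vv ->] := pv_surj B; have [w Vw ->] := pv_surj D.
have sV : {subset [:: x; y; u; v; w] <= vcodes}.
  by apply/allP; rewrite /all Vx Vy Vu Vv Vw.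
rewrite -[[:: _; _; _; _; _]]/(map pv [:: x; y; u; v; w]) is_cycle_pv // => cyc.
rewrite cycle_sgn_canon //.
by have /implyP/(_ (eqxx _)) := neg _ (cycles_mem sV cyc).
Qed.

Lemma canon_separated (t t' : petersen_type) :
  size (canon t) = size (canon t') ->
  (has_negative_pentagon_edge (canon_graph t) <->
   has_negative_pentagon_edge (canon_graph t')) ->
  t = t'.
Proof.
move=> eq_size eq_pent.
have {}eq_pent : canon_pentagon_edge t = canon_pentagon_edge t'.
  by apply/idP/idP => /canon_pentagon_edgeP/eq_pent/canon_pentagon_edgeP.
have pentE u : canon_pentagon_edge u = if u is (P_1 | P_2_3 | P_3_3) then true else false.
  by case: u; vm_compute.
rewrite !pentE in eq_pent.
by case: t eq_size eq_pent; case: t'.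
Qed.

Theorem theorem7p2 :
  (* each description determines a signed Petersen graph up to isomorphism *)
  (forall t : petersen_type,
     (exists sigma, has_type t (signed_petersen sigma)) /\
     (forall sigma sigma',
        has_type t (signed_petersen sigma) ->
        has_type t (signed_petersen sigma') ->
        isomorphic (signed_petersen sigma) (signed_petersen sigma'))) /\
  (* the six are pairwise nonisomorphic *)
  (forall (t t' : petersen_type) sigma sigma',
     has_type t (signed_petersen sigma) ->
     has_type t' (signed_petersen sigma') ->
     isomorphic (signed_petersen sigma) (signed_petersen sigma') -> t = t') /\
  (* they are precisely the minimal signed Petersen graphs *)
  (forall sigma,
     minimal (signed_petersen sigma) <->
     exists (t : petersen_type) sigma',
       has_type t (signed_petersen sigma') /\
       isomorphic (signed_petersen sigma) (signed_petersen sigma')) /\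
  (* each is the unique minimal one in its switching isomorphism class *)
  (forall (t : petersen_type) sigma,
     has_type t (signed_petersen sigma) ->
     minimal (signed_petersen sigma) /\
     forall S : signed_graph,
       switching_isomorphic S (signed_petersen sigma) ->
       minimal S -> isomorphic S (signed_petersen sigma)) /\
  (* frustration indices *)
  (forall (t : petersen_type) sigma,
     has_type t (signed_petersen sigma) ->
     frustration_index (signed_petersen sigma) =
     match t with
     | PlusP => 0
     | P_1 => 1
     | P_2_2 => 2
     | P_2_3 => 2
     | P_3_2 => 3
     | P_3_3 => 3
     end).
Proof.
have frustration t sigma : has_type t (signed_petersen sigma) ->
    frustration_index (signed_petersen sigma) = size (canon t).
  by move=> /has_type_canon/isomorphic_frustration ->; apply: canon_frustration.
have pentagon t sigma : has_type t (signed_petersen sigma) ->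
    has_negative_pentagon_edge (signed_petersen sigma) <->
    has_negative_pentagon_edge (canon_graph t).
  move=> /has_type_canon iso; split; apply: isomorphic_pentagon_edge => //.
  exact: isomorphic_sym.
have min_type t sigma : has_type t (signed_petersen sigma) ->
    minimal (signed_petersen sigma).
  move=> /has_type_canon/isomorphic_sym/isomorphic_minimal; apply.
  by rewrite /minimal canon_card canon_frustration.
split=> [t|]; last split=> [t t' sigma sigma' ts ts' iso|]; last split=> [sigma|]; last split.
- split=> [|sigma sigma' ts ts']; first by exists (canon_sgn t); apply: canon_has_type.
  by apply: isomorphic_trans (has_type_canon ts) _; apply/isomorphic_sym/has_type_canon.
- apply: canon_separated.
    by rewrite -(frustration _ _ ts) -(frustration _ _ ts') (isomorphic_frustration iso).
  apply: iff_trans (iff_sym (pentagon _ _ ts)) (iff_trans _ (pentagon _ _ ts')).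
  by split; apply: isomorphic_pentagon_edge => //; apply: isomorphic_sym.
- split=> [/minimal_canon[t iso]|[t [sigma' [/min_type min_s iso]]]].
    by exists t, (canon_sgn t); split; first exact: canon_has_type.
  exact: isomorphic_minimal (isomorphic_sym iso) min_s.
- move=> t sigma ts; split=> [|S [zeta iso] min_S]; first exact: min_type ts.
  (* A switching of a signed Petersen graph is again a signature [tau] on the same graph, so the
     classification applies to it. *)
  pose tau := @sgn (switch (S := signed_petersen sigma) zeta).
  have iso' : isomorphic S (signed_petersen tau) by [].
  have [t' iso_t'] := minimal_canon (isomorphic_minimal iso' min_S).
  have eq_t : t = t'.
    apply: canon_separated.
      rewrite -(frustration _ _ ts) -canon_frustration -(isomorphic_frustration iso_t').
      by rewrite -(frustration_switch (S := signed_petersen sigma) zeta).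
    apply: iff_trans (iff_sym (pentagon _ _ ts)) _.
    apply: iff_trans (iff_sym (switch_pentagon_edge zeta)) _.
    by split; apply: isomorphic_pentagon_edge => //; apply: isomorphic_sym.
  apply: isomorphic_trans iso' (isomorphic_trans iso_t' _).
  by rewrite -eq_t; apply/isomorphic_sym/has_type_canon.
- by move=> t sigma /frustration ->; case: t.
Qed.
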